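(* If $\mathrm{ZF}$ is consistent, then $\mathrm{ZFU}$ + Plenitude + $\mathrm{SVC}$ + Reflection Principle (RP) does not prove Plenitude$^+$.
   Context: $\mathrm{ZFU}$ is ZF set theory with urelements. Its language has $\in$ and a unary predicate $\mathscr{A}$ for urelements; $\mathscr{A}$ also denotes the class of all urelements. A set is an object that is not an urelement. The axioms are Foundation, Pairing, Union, Powerset, Infinity, the Separation schema, the Replacement schema (but not Collection), Extensionality for sets only, and the axiom that no urelement has members. The urelements may form a proper class. $x\preceq^* y$ means that there is a surjection from $y$ onto $x$ or $x=\emptyset$. Ordinals are transitive sets with no urelements in their transitive closure, well-ordered by $\in$. Plenitude: for every ordinal $\alpha$ there is a set of urelements equinumerous to $\alpha$. Plenitude$^+$: for every set $x$ there is a set of urelements equinumerous to $x$. $\mathrm{SVC}(S)$, for a set $S$: for every set $x$ there is an ordinal $\alpha$ such that $x\preceq^* S\times\alpha$. $\mathrm{SVC}$ (Small Violations of Choice): there is a set $S$ such that $\mathrm{SVC}(S)$. RP (schema, for each formula $\varphi$): for every set $x$ there is a transitive set $t$ with $x\subseteq t$ such that for all $x_1,\dots,x_n\in t$, $\varphi(x_1,\dots,x_n)\leftrightarrow\varphi^t(x_1,\dots,x_n)$, where $\varphi^t$ is the relativization of $\varphi$ to $t$. *)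

(* Defs.v *)
From Stdlib Require Import Arith List.

(** * First-order logic with equality, [∈] and unary predicates from [P]

    Variables are de Bruijn indices: [∀ φ] and [∃ φ] bind index 0 in [φ].
    There are no function symbols, so terms are variables and substitutions
    are maps [nat -> nat]. *)

Inductive form (P : Type) : Type :=
| fBot : form P
| fEq : nat -> nat -> form P
| fMem : nat -> nat -> form P
| fPred : P -> nat -> form P
| fImp : form P -> form P -> form P
| fAll : form P -> form P.

Arguments fBot {P}.
Arguments fEq {P} _ _.
Arguments fMem {P} _ _.
Arguments fPred {P} _ _.
Arguments fImp {P} _ _.
Arguments fAll {P} _.

Definition fNot {P} (φ : form P) := fImp φ fBot.
Definition fAnd {P} (φ ψ : form P) := fNot (fImp φ (fNot ψ)).
Definition fOr {P} (φ ψ : form P) := fImp (fNot φ) ψ.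
Definition fIff {P} (φ ψ : form P) := fAnd (fImp φ ψ) (fImp ψ φ).
Definition fEx {P} (φ : form P) := fNot (fAll (fNot φ)).

Declare Scope form_scope.
Delimit Scope form_scope with form.
Bind Scope form_scope with form.
Notation "x ∈ y" := (fMem x y) (at level 70, no associativity) : form_scope.
Notation "x == y" := (fEq x y) (at level 70, no associativity) : form_scope.
Notation "~ φ" := (fNot φ) : form_scope.
Notation "φ /\ ψ" := (fAnd φ ψ) : form_scope.
Notation "φ \/ ψ" := (fOr φ ψ) : form_scope.
Notation "φ <-> ψ" := (fIff φ ψ) : form_scope.
Notation "φ --> ψ" := (fImp φ ψ) (at level 99, right associativity) : form_scope.
Notation "∀ φ" := (fAll φ) (at level 75, right associativity) : form_scope.
Notation "∃ φ" := (fEx φ) (at level 75, right associativity) : form_scope.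

Definition up (r : nat -> nat) (n : nat) : nat :=
  match n with 0 => 0 | S m => S (r m) end.

Fixpoint ren {P} (r : nat -> nat) (φ : form P) : form P :=
  match φ with
  | fBot => fBot
  | fEq x y => fEq (r x) (r y)
  | fMem x y => fMem (r x) (r y)
  | fPred p x => fPred p (r x)
  | fImp φ ψ => fImp (ren r φ) (ren r ψ)
  | fAll φ => fAll (ren (up r) φ)
  end.

(** [inst t φ]: replace index 0 of [φ] by the variable [t], lowering the others. *)
Definition inst {P} (t : nat) : form P -> form P :=
  ren (fun n => match n with 0 => t | S m => m end).

(** The least [n] such that every free variable of [φ] is [< n]. *)
Fixpoint fbound {P} (φ : form P) : nat :=
  match φ with
  | fBot => 0
  | fEq x y => Nat.max (S x) (S y)
  | fMem x y => Nat.max (S x) (S y)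
  | fPred _ x => S x
  | fImp φ ψ => Nat.max (fbound φ) (fbound ψ)
  | fAll φ => Nat.pred (fbound φ)
  end.

Definition closure {P} (φ : form P) : form P := Nat.iter (fbound φ) fAll φ.

(** Classical natural deduction. *)
Inductive deriv {P : Type} : list (form P) -> form P -> Prop :=
| d_ax Γ φ : In φ Γ -> deriv Γ φ
| d_impI Γ φ ψ : deriv (φ :: Γ) ψ -> deriv Γ (φ --> ψ)%form
| d_impE Γ φ ψ : deriv Γ (φ --> ψ)%form -> deriv Γ φ -> deriv Γ ψ
| d_raa Γ φ : deriv ((~ φ)%form :: Γ) fBot -> deriv Γ φ
| d_allI Γ φ : deriv (map (ren S) Γ) φ -> deriv Γ (∀ φ)%form
| d_allE Γ φ t : deriv Γ (∀ φ)%form -> deriv Γ (inst t φ)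
| d_eqI Γ x : deriv Γ (x == x)%form
| d_eqE Γ φ x y :
    deriv Γ (x == y)%form -> deriv Γ (inst x φ) -> deriv Γ (inst y φ).

Definition theory (P : Type) := form P -> Prop.

Definition proves {P} (T : theory P) (φ : form P) : Prop :=
  exists Γ : list (form P), Forall T Γ /\ deriv Γ φ.

Definition consistent {P} (T : theory P) : Prop := ~ proves T fBot.

(** * Axioms of set theory

    [st x] is the formula "[x] is a set"; it is trivially true in ZF and says
    that [x] is not an urelement in ZFU. *)

Definition fSub {P} (x y : nat) : form P := (∀ (0 ∈ S x --> 0 ∈ S y))%form.

Section SetAxioms.
Context {P : Type} (st : nat -> form P).
Open Scope form_scope.

Definition allS (φ : form P) : form P := ∀ (st 0 --> φ).
Definition exS (φ : form P) : form P := ∃ (st 0 /\ φ).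

Definition ax_extensionality : form P :=
  allS (allS ((∀ (0 ∈ 1 <-> 0 ∈ 2)) --> 0 == 1)).

Definition ax_foundation : form P :=
  allS ((∃ 0 ∈ 1) --> ∃ (0 ∈ 1 /\ ~ ∃ (0 ∈ 1 /\ 0 ∈ 2))).

Definition ax_pairing : form P :=
  ∀ ∀ exS (∀ (0 ∈ 1 <-> (0 == 2 \/ 0 == 3))).

Definition ax_union : form P :=
  allS (exS (∀ (0 ∈ 1 <-> ∃ (0 ∈ 3 /\ 1 ∈ 0)))).

Definition ax_powerset : form P :=
  allS (exS (∀ (0 ∈ 1 <-> (st 0 /\ fSub 0 2)))).

Definition ax_infinity : form P :=
  exS ((∃ (0 ∈ 1 /\ (st 0 /\ ∀ ~ 0 ∈ 1)))
       /\ ∀ (0 ∈ 1 --> ∃ (0 ∈ 2 /\ (st 0 /\ ∀ (0 ∈ 1 <-> (0 ∈ 2 \/ 0 == 2)))))).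

(** In [φ], index 0 is the element [z], index 1 is the given set [x], and the
    further indices are parameters: [∀x ∃y ∀z (z ∈ y <-> z ∈ x /\ φ(z,x,..))]. *)
Definition ax_separation (φ : form P) : form P :=
  closure (allS (exS (∀ (0 ∈ 1 <-> (0 ∈ 2 /\ ren (up S) φ))))).

(** In [φ], index 0 is the value [y], index 1 the argument [x], index 2 the
    domain [w], and the further indices are parameters:
    [∀w ((∀x ∈ w) ∃!y φ(y,x,w,..) -> ∃v ∀y (y ∈ v <-> (∃x ∈ w) φ(y,x,w,..)))]. *)
Definition ax_replacement (φ : form P) : form P :=
  closure
    (allS ((∀ (0 ∈ 1 --> ∃ ∀ (ren (up S) φ <-> 0 == 1)))
           --> exS (∀ (0 ∈ 1 <->
                 ∃ (0 ∈ 3 /\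
                    ren (fun n => match n with
                                  | 0 => 1 | 1 => 0 | S (S k) => S (S (S k))
                                  end) φ))))).

Inductive set_axiom : theory P :=
| sa_extensionality : set_axiom ax_extensionality
| sa_foundation : set_axiom ax_foundation
| sa_pairing : set_axiom ax_pairing
| sa_union : set_axiom ax_union
| sa_powerset : set_axiom ax_powerset
| sa_infinity : set_axiom ax_infinity
| sa_separation φ : set_axiom (ax_separation φ)
| sa_replacement φ : set_axiom (ax_replacement φ).

End SetAxioms.

(** The language of ZF has no unary predicate. *)
Definition ZF : theory Empty_set := set_axiom (fun _ => fNot fBot).

(** * ZF with urelements: one unary predicate *)

Definition uform := form unit.

Open Scope form_scope.

Definition urel (x : nat) : uform := fPred tt x.
Definition isset (x : nat) : uform := ~ urel x.

Definition ax_urelements : uform := ∀ (urel 0 --> ~ ∃ 0 ∈ 1).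

Inductive ZFU : theory unit :=
| ZFU_set φ : set_axiom isset φ -> ZFU φ
| ZFU_urelements : ZFU ax_urelements.

Definition all_set : uform -> uform := allS isset.
Definition ex_set : uform -> uform := exS isset.
Definition all_in (x : nat) (φ : uform) : uform := ∀ (0 ∈ S x --> φ).
Definition ex_in (x : nat) (φ : uform) : uform := ∃ (0 ∈ S x /\ φ).

(** [u = {x, y}] *)
Definition is_upair (u x y : nat) : uform :=
  isset u /\ ∀ (0 ∈ S u <-> (0 == S x \/ 0 == S y)).

(** [p = (x, y) = {{x}, {x, y}}] *)
Definition is_pair (p x y : nat) : uform :=
  ∃ ∃ (is_upair 1 (2 + x) (2 + x) /\
       (is_upair 0 (2 + x) (2 + y) /\ is_upair (2 + p) 1 0)).

(** [(x, y) ∈ f] *)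
Definition pair_in (f x y : nat) : uform :=
  ex_in f (is_pair 0 (S x) (S y)).

(** [c = a × b] *)
Definition is_prod (c a b : nat) : uform :=
  isset c /\
  ∀ (0 ∈ S c <-> ex_in (S a) (ex_in (2 + b) (is_pair 2 1 0))).

(** [f : a -> b] *)
Definition is_fun (f a b : nat) : uform :=
  isset f /\
  (all_in f (ex_in (S a) (ex_in (2 + b) (is_pair 2 1 0))) /\
   all_in a (∃ ∀ (pair_in (3 + f) 2 0 <-> 0 == 1))).

Definition is_surj (f a b : nat) : uform :=
  is_fun f a b /\ all_in b (ex_in (S a) (pair_in (2 + f) 0 1)).

Definition is_bij (f a b : nat) : uform :=
  is_surj f a b /\
  all_in a (all_in (S a) (all_in (2 + b)
    ((pair_in (3 + f) 2 0 /\ pair_in (3 + f) 1 0) --> 2 == 1))).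

Definition equinumerous (x y : nat) : uform := ∃ (is_bij 0 (S x) (S y)).

(** [x ⪯* y] *)
Definition surj_le (x y : nat) : uform :=
  (∃ (is_surj 0 (S y) (S x))) \/ (isset x /\ ∀ ~ 0 ∈ S x).

Definition transitive_set (x : nat) : uform :=
  isset x /\ all_in x (all_in 0 (0 ∈ 2 + x)).

(** [t] is the least transitive set including [x] *)
Definition is_trcl (t x : nat) : uform :=
  (transitive_set t /\ fSub x t) /\
  all_set ((transitive_set 0 /\ fSub (S x) 0) --> fSub (S t) 0).

(** [∈] restricted to [x] is a strict well-order *)
Definition wellordered_by_mem (x : nat) : uform :=
  all_in x (~ 0 ∈ 0) /\
  (all_in x (all_in (S x) (all_in (2 + x) ((2 ∈ 1 /\ 1 ∈ 0) --> 2 ∈ 0))) /\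
  (all_in x (all_in (S x) (1 ∈ 0 \/ (1 == 0 \/ 0 ∈ 1))) /\
   all_set ((fSub 0 (S x) /\ ∃ 0 ∈ 1) -->
            ex_in 0 (all_in 1 (1 == 0 \/ 1 ∈ 0))))).

Definition is_ordinal (x : nat) : uform :=
  transitive_set x /\
  ((∃ (is_trcl 0 (S x) /\ all_in 0 (isset 0))) /\
   wellordered_by_mem x).

Definition set_of_urelements (x : nat) : uform :=
  isset x /\ all_in x (urel 0).

Definition Plenitude : uform :=
  ∀ (is_ordinal 0 --> ∃ (set_of_urelements 0 /\ equinumerous 0 1)).

Definition PlenitudePlus : uform :=
  all_set (∃ (set_of_urelements 0 /\ equinumerous 0 1)).

(** [∀x (x is a set -> ∃α (α is an ordinal /\ x ⪯* s × α))] *)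
Definition SVC_of (s : nat) : uform :=
  all_set (∃ (is_ordinal 0 /\
              ∃ (is_prod 0 (3 + s) 1 /\ surj_le 2 0))).

Definition SVC : uform := ex_set (SVC_of 0).

(** [φ^t] *)
Fixpoint relativize (t : nat) (φ : uform) : uform :=
  match φ with
  | fImp φ ψ => relativize t φ --> relativize t ψ
  | fAll φ => ∀ (0 ∈ S t --> relativize (S t) φ)
  | atom => atom
  end.

(** [(∀x_{n-1} ∈ t) ... (∀x_0 ∈ t) φ]; inside [φ] the variable [t] has become
    [n + t]. *)
Fixpoint all_in_iter (n t : nat) (φ : uform) : uform :=
  match n with
  | 0 => φ
  | S n => all_in t (all_in_iter n (S t) φ)
  end.

(** All free variables of [φ] are among the [fbound φ] bound ones, so [t] is
    index [fbound φ] in the biconditional and does not occur in [φ]. *)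
Definition RP (φ : uform) : uform :=
  let n := fbound φ in
  all_set (∃ (transitive_set 0 /\
              (fSub 1 0 /\ all_in_iter n 0 (φ <-> relativize n φ)))).

Inductive ZFU_Plenitude_SVC_RP : theory unit :=
| T_ZFU φ : ZFU φ -> ZFU_Plenitude_SVC_RP φ
| T_Plenitude : ZFU_Plenitude_SVC_RP Plenitude
| T_SVC : ZFU_Plenitude_SVC_RP SVC
| T_RP φ : ZFU_Plenitude_SVC_RP (RP φ).

Close Scope form_scope.

(* Main.v *)
Require Import Defs.
From Stdlib Require Import Arith List Lia.
From Stdlib Require Setoid.
From Corelib Require Import ssreflect ssrfun.
From mathcomp Require boolp wochoice.
Import boolp(cid, funext, propext, contrapT, Prop_irrelevance, EM, choice).

(** A permutation model does it.  Take as urelements, on the one hand,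
    countably many pairs [{moving k false, moving k true}] and, on the other
    hand, a proper class of inert urelements.  The group [nat -> bool] acts by
    flipping the [k]-th pair when [g k] is true; it fixes the inert urelements.
    The model [U] consists of the hereditarily symmetric objects: those fixed
    by every [g] that leaves the first [n] pairs alone, for some [n], and whose
    members have the same property, and so on down.

    The universe of types itself serves as the ground model: sets are
    well-founded trees branching over an arbitrary type, taken up to
    bisimulation.  Types in the universe of the branching types are the small
    ones, and propositional impredicativity together with choice gives
    separation, powerset and replacement.  Everything about forming sets in [U]
    is in [comprehension]: a class that is small and invariant under almost all
    flips is a set.  The set existence axioms reduce to it, because a class defined
    by a formula with parameters is invariant under the flips that fix the
    parameters ([supported_sat]).

    - Plenitude: an ordinal is hereditarily free of urelements, so the flips
      fix all its members, and labelling inert urelements by them is a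
      symmetric bijection ([Plenitude_valid]).
    - SVC: let [S] be the set of the finite selections
      [{moving k (h k) : k < n}].  Two flips that agree on a selection of
      length [n] agree on every object supported by the first [n] pairs.  So if
      [i] indexes a member [y] of [x] and [n] supports [y], then mapping [g]
      applied to a selection of length [n] to [g] applied to [y], for the flips
      [g] that fix a support of [x], is well defined.  These maps, taken over
      all indices [i] coded as elements of an ordinal, form a symmetric
      surjection from S × α onto [x] ([SVC_valid]).
    - Plenitude+ fails at [S] itself: a bijection in [U] commutes with the
      flips of the pairs [n] and [n + 1] for large [n].  Both of them move a
      selection of length [n + 2], whereas no urelement is moved by both
      ([selections_not_equinumerous]).
    - RP: a Löwenheim–Skolem argument.  Starting from the members of a set and
      adding in turn witnesses, members and images under flips, ω steps give
      a small, transitive, invariant and elementary class, that is, a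
      transitive set which reflects all formulas at once
      ([elementary_transitive_set]).

    By soundness no theorem of the theory fails in [U]. *)

Local Close Scope form_scope.

Set Implicit Arguments.
Unset Strict Implicit.

(** * The group of flips *)

Definition flips := nat -> bool.
Definition no_flip : flips := fun _ => false.
Definition flip_comp (g h : flips) : flips := fun k => xorb (g k) (h k).

(** The subgroups [fixes n] generate the normal filter of the permutation
    model.  The group is abelian, so a support of an object also supports all
    its images. *)
Definition fixes (n : nat) (g : flips) := forall k, k < n -> g k = false.

Lemma flip_compC g h : flip_comp g h = flip_comp h g.
Proof. by apply: funext => k; rewrite /flip_comp Bool.xorb_comm. Qed.

Lemma flip_compK g : flip_comp g g = no_flip.
Proof. by apply: funext => k; rewrite /flip_comp Bool.xorb_nilpotent. Qed.

Lemma fixes_le n m g : n <= m -> fixes m g -> fixes n g.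
Proof. by move=> nm gm k kn; apply: gm; lia. Qed.

Lemma fixes_comp n g h : fixes n g -> fixes n h -> fixes n (flip_comp g h).
Proof. by move=> gn hn k kn; rewrite /flip_comp gn // hn. Qed.

(** * Trees up to bisimulation *)

(** An inert urelement carries a tree as a label, so that there are at least
    as many of them as there are sets. *)
Inductive tree : Type :=
| moving (k : nat) (b : bool)
| inert (t : tree)
| node (X : Type) (f : X -> tree).

Fixpoint eqv (s t : tree) : Prop :=
  match s, t with
  | moving k b, moving k' b' => k = k' /\ b = b'
  | inert s, inert t => s = t
  | node X f, node Y g =>
      (forall i, exists j, eqv (f i) (g j)) /\
      (forall j, exists i, eqv (f i) (g j))
  | _, _ => False
  end.

Lemma eqv_refl t : eqv t t.
Proof.
elim: t => //= X f IH.
by split=> i; exists i.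
Qed.

Lemma eqv_sym s t : eqv s t -> eqv t s.
Proof.
elim: s t => [k b|s _|X f IH] [k' b'|t|Y g] //=.
- by case=> -> ->.
- case=> fg gf; split=> [j|i].
  + by have [i /IH] := gf j; exists i.
  + by have [j /IH] := fg i; exists j.
Qed.

Lemma eqv_trans s t u : eqv s t -> eqv t u -> eqv s u.
Proof.
elim: s t u => [k b|s _|X f IH] [k' b'|t|Y g] [k'' b''|u|Z h] //=.
- by case=> -> ->.
- by move=> ->.
- case=> fg gf [gh hg]; split=> [i|l].
  + have [j ij] := fg i; have [l jl] := gh j.
    by exists l; apply: IH ij jl.
  + have [j jl] := hg l; have [i ij] := gf j.
    by exists i; apply: IH ij jl.
Qed.

(** Labels of inert urelements are left alone, even where they mention moving
    ones. *)
Fixpoint tact (g : flips) (t : tree) : tree :=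
  match t with
  | moving k b => moving k (xorb (g k) b)
  | inert t => inert t
  | node X f => node (fun i => tact g (f i))
  end.

Lemma tact_comp g h t : tact g (tact h t) = tact (flip_comp g h) t.
Proof.
elim: t => [k b|t _|X f IH] //=.
- by rewrite Bool.xorb_assoc.
- by congr node; apply: funext.
Qed.

Lemma tact_no_flip t : tact no_flip t = t.
Proof.
elim: t => [k b|t _|X f IH] //=.
by congr node; apply: funext.
Qed.

Lemma eqv_tact g s t : eqv s t -> eqv (tact g s) (tact g t).
Proof.
elim: s t => [k b|s _|X f IH] [k' b'|t|Y h] //=.
- by case=> -> ->.
- case=> fg gf; split=> [i|j].
  + by have [j /IH] := fg i; exists j.
  + by have [i /IH] := gf j; exists i.
Qed.

Definition tree_supp (n : nat) (t : tree) :=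
  forall g, fixes n g -> eqv (tact g t) t.

Fixpoint hereditarily_symmetric (t : tree) : Prop :=
  match t with
  | node X f => (exists n, tree_supp n t) /\ forall i, hereditarily_symmetric (f i)
  | _ => True
  end.

Lemma tree_supp_eqv n s t : eqv s t -> tree_supp n s -> tree_supp n t.
Proof.
move=> st sn g gn.
apply: eqv_trans (eqv_trans (sn g gn) st).
exact/eqv_tact/eqv_sym.
Qed.

Lemma tree_supp_tact n h t : tree_supp n t -> tree_supp n (tact h t).
Proof.
by move=> tn g gn; rewrite tact_comp flip_compC -tact_comp; apply/eqv_tact/tn.
Qed.

Lemma hsym_eqv s t : eqv s t -> hereditarily_symmetric s -> hereditarily_symmetric t.
Proof.
elim: s t => [k b|s _|X f IH] [k' b'|t|Y g] //= st [[n sn] fs]; split.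
- by exists n; apply: (tree_supp_eqv (s := node f)) sn.
- by case: st => _ gf j; have [i /IH] := gf j; apply.
Qed.

Lemma hsym_tact g t : hereditarily_symmetric t -> hereditarily_symmetric (tact g t).
Proof.
elim: t => [k b|s _|X f IH] //= [[n tn] fs]; split.
- by exists n; apply: (@tree_supp_tact n g (node f)).
- by move=> i; apply: IH.
Qed.

Lemma tree_supp_ex t : hereditarily_symmetric t -> exists n, tree_supp n t.
Proof.
case: t => [k b _|t _|X f []//].
- exists (S k) => g gk /=; rewrite gk //.
- by exists 0.
Qed.

(** * The universe of hereditarily symmetric objects *)

Definition pick (T : Type) (P : T -> Prop) (ex : exists x, P x) : T := sval (cid ex).

Lemma pickP (T : Type) (P : T -> Prop) (ex : exists x, P x) : P (pick ex).
Proof. exact: svalP (cid ex). Qed.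

(** Choosing from extensionally equal predicates gives equal results.  This is
    what makes the choice of a representative canonical, so that bisimilar
    trees become equal. *)
Lemma pick_eq (T : Type) (P Q : T -> Prop) (exP : exists x, P x) (exQ : exists x, Q x) :
  P = Q -> pick exP = pick exQ.
Proof. by move=> E; move: exP; rewrite E => exP; rewrite (Prop_irrelevance exP exQ). Qed.

Definition canon (t : tree) : tree :=
  @pick tree (fun s => eqv t s) (ex_intro _ t (eqv_refl t)).

Lemma canonP t : eqv t (canon t).
Proof. exact: (pickP (P := fun s => eqv t s)). Qed.

Lemma canon_eq s t : eqv s t -> canon s = canon t.
Proof.
move=> st; apply: pick_eq.
apply: funext => u; apply: propext; split.
- exact/eqv_trans/eqv_sym.
- exact/eqv_trans.
Qed.

Definition U : Type := {t : tree | hereditarily_symmetric t /\ canon t = t}.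

Lemma class_of_proof t :
  hereditarily_symmetric t -> hereditarily_symmetric (canon t) /\ canon (canon t) = canon t.
Proof.
move=> ht; split; first exact: hsym_eqv (canonP t) ht.
exact/esym/canon_eq/canonP.
Qed.

Definition class_of t (ht : hereditarily_symmetric t) : U := exist _ (canon t) (class_of_proof ht).

Lemma val_hsym (x : U) : hereditarily_symmetric (sval x).
Proof. by case: (svalP x). Qed.

Lemma val_eqv (x y : U) : eqv (sval x) (sval y) -> x = y.
Proof.
case: x y => [s [hs cs]] [t [ht ct]] /= st.
have E : s = t by rewrite -cs -ct; apply: canon_eq.
move: hs cs ht ct; rewrite E => *.
by congr exist; apply: Prop_irrelevance.
Qed.

Lemma val_class_of t (ht : hereditarily_symmetric t) : eqv (sval (class_of ht)) t.
Proof. exact/eqv_sym/canonP. Qed.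

Lemma class_of_unique (x : U) t (ht : hereditarily_symmetric t) : eqv (sval x) t -> x = class_of ht.
Proof. by move=> xt; apply/val_eqv/(eqv_trans xt)/canonP. Qed.

Definition urelement (x : U) : Prop :=
  match sval x with node _ _ => False | _ => True end.

Definition mem (x y : U) : Prop :=
  match sval y with
  | node X f => exists i, eqv (sval x) (f i)
  | _ => False
  end.

Lemma mem_ext x y :
  ~ urelement x -> ~ urelement y -> (forall z, mem z x <-> mem z y) -> x = y.
Proof.
rewrite /urelement /mem => sx sy xy; apply: val_eqv; move: sx sy xy.
have := val_hsym y; have := val_hsym x.
case: (sval x) => [||X f] //; case: (sval y) => [||Y h] //=.
move=> [_ hf] [_ hh] _ _ xy; split=> [i|j].
- have [|j ij] := (xy (class_of (hf i))).1; first by exists i; apply: val_class_of.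
  exists j; exact: eqv_trans (eqv_sym (val_class_of _)) ij.
- have [|i ij] := (xy (class_of (hh j))).2; first by exists j; apply: val_class_of.
  exists i; apply: eqv_sym; exact: eqv_trans (eqv_sym (val_class_of _)) ij.
Qed.

Lemma mem_not_urelement x y : mem x y -> ~ urelement y.
Proof. by rewrite /mem /urelement; case: (sval y) => [||X f] //= _ []. Qed.

Lemma mem_ind (P : U -> Prop) :
  (forall x, (forall y, mem y x -> P y) -> P x) -> forall x, P x.
Proof.
move=> IH.
suff H t : forall x, eqv (sval x) t -> P x by move=> x; apply: (H (sval x)); apply: eqv_refl.
elim: t => [k b|t _|X f IHf] x xt; apply: IH => y; rewrite /mem;
  move: xt; case: (sval x) => [||Y h] //= [hf fh] [j yj].
have [i ji] := hf j; apply: (IHf i); exact: eqv_trans yj ji.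
Qed.

(** ** The flips as automorphisms *)

Definition act (g : flips) (x : U) : U := class_of (hsym_tact g (val_hsym x)).

Lemma val_act g x : eqv (sval (act g x)) (tact g (sval x)).
Proof. exact: val_class_of. Qed.

Lemma act_comp g h x : act g (act h x) = act (flip_comp g h) x.
Proof.
apply/val_eqv/(eqv_trans (val_act _ _)).
apply: eqv_trans (eqv_tact _ (val_act _ _)) _.
by rewrite tact_comp; apply/eqv_sym/val_act.
Qed.

Lemma actK g x : act g (act g x) = x.
Proof.
rewrite act_comp flip_compK; apply: val_eqv.
by apply: eqv_trans (val_act _ _) _; rewrite tact_no_flip; apply: eqv_refl.
Qed.

Lemma mem_act g x y : mem (act g x) (act g y) <-> mem x y.
Proof.
suff H h u w : mem u w -> mem (act h u) (act h w).
  by split; [move/(H g); rewrite !actK | apply: H].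
rewrite /mem; move: (val_act h u) (val_act h w).
move: (sval (act h u)) (sval (act h w)) => u' w' uu'.
case: (sval w) => [||X f] //=; case: w' => [||Y f'] //= [_ fX] [i ui].
have [j ji] := fX i; exists j.
by apply: eqv_trans uu' (eqv_trans (eqv_tact _ ui) (eqv_sym ji)).
Qed.

Lemma urelement_act g x : urelement (act g x) <-> urelement x.
Proof.
rewrite /urelement; move: (val_act g x).
by move: (sval (act g x)) => y; case: (sval x) => [||X f] //=; case: y.
Qed.

Definition supp (n : nat) (x : U) := forall g, fixes n g -> act g x = x.

Lemma supp_le n m x : n <= m -> supp n x -> supp m x.
Proof. by move=> nm xn g /(fixes_le nm); apply: xn. Qed.

Lemma supp_ex x : exists n, supp n x.
Proof.
have [n xn] := tree_supp_ex (val_hsym x); exists n => g /xn gx.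
by apply: val_eqv; apply: eqv_trans (val_act _ _) gx.
Qed.

Definition moving_atom k b : U := @class_of (moving k b) I.
Definition inert_atom (x : U) : U := @class_of (inert (sval x)) I.

Lemma urelement_inert_atom x : urelement (inert_atom x).
Proof.
rewrite /urelement; have := val_class_of (t := inert (sval x)) I.
by rewrite -/(inert_atom x); case: (sval _).
Qed.

Lemma moving_atom_inj k b k' b' : moving_atom k b = moving_atom k' b' -> k = k' /\ b = b'.
Proof.
move=> E.
have H := val_class_of (t := moving k b) I.
have : eqv (moving k b) (moving k' b'); last by [].
apply: eqv_trans (eqv_sym H) _; rewrite -/(moving_atom k b) E; exact: val_class_of.
Qed.

Lemma inert_atom_inj x y : inert_atom x = inert_atom y -> x = y.
Proof.
move=> E.
have H := val_class_of (t := inert (sval x)) I.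
have : eqv (inert (sval x)) (inert (sval y)).
  apply: eqv_trans (eqv_sym H) _; rewrite -/(inert_atom x) E; exact: val_class_of.
by move=> /= xy; apply: val_eqv; rewrite xy; apply: eqv_refl.
Qed.

Lemma act_moving_atom g k b : act g (moving_atom k b) = moving_atom k (xorb (g k) b).
Proof.
apply: val_eqv; apply: eqv_trans (val_act _ _) _.
by apply: eqv_trans (eqv_tact _ (val_class_of _)) _; apply/eqv_sym/val_class_of.
Qed.

Lemma act_inert_atom g x : act g (inert_atom x) = inert_atom x.
Proof.
apply: val_eqv; apply: eqv_trans (val_act _ _) _.
by apply: eqv_trans (eqv_tact _ (val_class_of _)) _; apply/eqv_sym/val_class_of.
Qed.

(** A flip moves an urelement only inside the single pair that it belongs to;
    hence two flips of different pairs never move the same urelement. *)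
Lemma urelement_moved g x :
  urelement x -> act g x <> x -> exists k b, x = moving_atom k b /\ g k = true.
Proof.
move=> ux gx; have := ux; rewrite /urelement.
case E: (sval x) => [k b|t|//] _.
- have X : x = moving_atom k b by apply: class_of_unique; rewrite E; apply: eqv_refl.
  exists k, b; split=> //; case gk: (g k) => //; case: gx.
  by rewrite X act_moving_atom gk.
- case: gx; apply: val_eqv; apply: eqv_trans (val_act _ _) _.
  by rewrite E; apply: eqv_refl.
Qed.

(** * Small classes and set formation *)

(** [X] ranges over the universe of the branching types, which lies below the
    universe of [U]; so [U] itself is not small. *)
Definition small (P : U -> Prop) :=
  exists (X : Type) (f : X -> U), forall z, P z -> exists i, z = f i.

Definition supported (P : U -> Prop) :=
  exists n, forall g, fixes n g -> forall z, P z -> P (act g z).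

(** The only set existence principle of [U]: smallness provides a branching
    type, and a support of the class supports the tree. *)
Lemma comprehension P : small P -> supported P ->
  exists y, ~ urelement y /\ forall z, mem z y <-> P z.
Proof.
move=> [X [f fP]] [n Pn].
pose t := node (fun i : {i | P (f i)} => sval (f (sval i))).
have tn : tree_supp n t.
  move=> g gn; split=> -[i Pi] /=.
  - have /fP [j gj] := Pn g gn _ Pi.
    have Pj : P (f j) by rewrite -gj; apply: Pn.
    by exists (exist _ j Pj) => /=; rewrite -gj; apply/eqv_sym/val_act.
  - have /fP [j gj] := Pn g gn _ Pi.
    have Pj : P (f j) by rewrite -gj; apply: Pn.
    exists (exist _ j Pj) => /=; rewrite -gj.
    by apply: eqv_trans (eqv_sym (val_act _ _)) _; rewrite actK; apply: eqv_refl.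
have ht : hereditarily_symmetric t by split; [exists n | move=> i; apply: val_hsym].
exists (class_of ht); rewrite /urelement /mem; move: (val_class_of ht).
move: (sval (class_of ht)) => s; case: s => [||Y h] //= [ht1 ht2]; split=> [[]|z]; split.
- move=> [j zj]; have [[i Pi] /= ji] := ht1 j.
  by rewrite (val_eqv (eqv_trans zj ji)).
- move=> Pz; have [i zi] := fP _ Pz; rewrite zi in Pz *.
  by have [j] := ht2 (exist _ i Pz); exists j; apply: eqv_sym.
Qed.

Lemma small_mem x : small (fun z => mem z x).
Proof.
rewrite /mem; have := val_hsym x.
case: (sval x) => [k b _|t _|X f [_ hf]].
- by exists False, (fun a : False => match a with end) => z.
- by exists False, (fun a : False => match a with end) => z.
- exists X, (fun i => class_of (hf i)) => z [i zi]; exists i; exact: class_of_unique.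
Qed.

Lemma small_sub (P Q : U -> Prop) : (forall z, P z -> Q z) -> small Q -> small P.
Proof. by move=> PQ [X [f fP]]; exists X, f => z /PQ/fP. Qed.

Lemma small_image (X : Type) (f : X -> U) : small (fun z => exists i, z = f i).
Proof. by exists X, f. Qed.

Lemma small_bigcup (X : Type) (P : X -> U -> Prop) :
  (forall i, small (P i)) -> small (fun z => exists i, P i z).
Proof.
move=> sP.
have [|Y fP] := choice (P := fun i (Y : {Y : Type & Y -> U}) =>
    forall z, P i z -> exists j, z = projT2 Y j).
  by move=> i; have [Y [f fP]] := sP i; exists (existT _ Y f).
exists {i : X & projT1 (Y i)}, (fun p => projT2 (Y (projT1 p)) (projT2 p)).
by move=> z [i /fP[j ->]]; exists (existT _ i j).
Qed.

Lemma small_union (P : U -> Prop) (Q : U -> U -> Prop) :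
  small P -> (forall x, P x -> small (Q x)) ->
  small (fun z => exists x, P x /\ Q x z).
Proof.
move=> [X [f fP]] sQ.
apply: (@small_sub _ (fun z => exists i, P (f i) /\ Q (f i) z)).
  by move=> z [x [Px Qxz]]; have [i xi] := fP _ Px; exists i; rewrite -xi.
apply: small_bigcup => i.
have [Pi|nPi] := EM (P (f i)).
- by apply: small_sub (sQ _ Pi) => z [].
- by exists False, (fun a : False => match a with end) => z [].
Qed.

Definition is_set_of (P : U -> Prop) (y : U) :=
  ~ urelement y /\ forall z, mem z y <-> P z.

(** The vacuous case lets [setof] be a total function. *)
Lemma setof_ex (P : U -> Prop) :
  exists y, (exists y', is_set_of P y') -> is_set_of P y.
Proof.
have [[y Py]|nP] := EM (exists y', is_set_of P y'); first by exists y.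
by exists (moving_atom 0 false) => /nP.
Qed.

Definition setof (P : U -> Prop) : U := pick (setof_ex P).

Section Setof.
Variables (P : U -> Prop) (sP : small P) (symP : supported P).

Lemma setofP : is_set_of P (setof P).
Proof. exact: (pickP (setof_ex P)) (comprehension sP symP). Qed.

Lemma setof_set : ~ urelement (setof P).
Proof. by have [] := setofP. Qed.

Lemma mem_setof z : mem z (setof P) <-> P z.
Proof. by have [_] := setofP. Qed.

Lemma setof_eq x : ~ urelement x -> (forall z, mem z x <-> P z) -> x = setof P.
Proof.
by move=> sx xP; apply: mem_ext => // [|z]; [exact: setof_set | rewrite mem_setof].
Qed.

End Setof.

Lemma act_inj g x y : act g x = act g y -> x = y.
Proof. by move=> E; rewrite -(actK g x) E actK. Qed.

Lemma mem_actl g x y : mem (act g x) y <-> mem x (act g y).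
Proof. by rewrite -{1}(actK g y) mem_act. Qed.

(** ** Pairs *)

Lemma supp2 x y : exists n, supp n x /\ supp n y.
Proof.
have [n xn] := supp_ex x; have [m ym] := supp_ex y.
exists (Nat.max n m); split.
- by apply: supp_le xn; lia.
- by apply: supp_le ym; lia.
Qed.

Lemma small_upair x y : small (fun z => z = x \/ z = y).
Proof.
exists bool, (fun b : bool => if b then x else y).
by move=> z [->|->]; [exists true | exists false].
Qed.

Lemma supported_upair x y : supported (fun z => z = x \/ z = y).
Proof.
have [n [xn yn]] := supp2 x y; exists n => g gn z [->|->].
- by left; apply: xn.
- by right; apply: yn.
Qed.

Definition upair x y := setof (fun z => z = x \/ z = y).

Lemma mem_upair x y z : mem z (upair x y) <-> z = x \/ z = y.
Proof. exact: mem_setof (small_upair x y) (supported_upair x y) z. Qed.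

Lemma upair_set x y : ~ urelement (upair x y).
Proof. exact: setof_set (small_upair x y) (supported_upair x y). Qed.

Lemma upairE u x y :
  ~ urelement u /\ (forall z, mem z u <-> z = x \/ z = y) <-> u = upair x y.
Proof.
split=> [[su uP]|->].
- exact: setof_eq (small_upair x y) (supported_upair x y) _ su uP.
- by split; [exact: upair_set | exact: mem_upair].
Qed.

Lemma act_upair g x y : act g (upair x y) = upair (act g x) (act g y).
Proof.
apply/upairE; split; first by rewrite urelement_act; apply: upair_set.
move=> z; rewrite -mem_actl mem_upair.
have E w : act g z = w <-> z = act g w.
  by split=> [<-|->]; rewrite actK.
by rewrite !E.
Qed.

Definition pair x y := upair (upair x x) (upair x y).

Lemma act_pair g x y : act g (pair x y) = pair (act g x) (act g y).
Proof. by rewrite /pair !act_upair. Qed.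

Lemma upair_inj x y y' : upair x y = upair x y' -> y = y'.
Proof.
move=> E.
have : mem y' (upair x y) by rewrite E mem_upair; right.
have : mem y (upair x y') by rewrite -E mem_upair; right.
by rewrite !mem_upair => -[|->] // -> [].
Qed.

Lemma pair_inj x y x' y' : pair x y = pair x' y' -> x = x' /\ y = y'.
Proof.
move=> E.
have xx : x = x'.
  have : mem (upair x x) (pair x' y') by rewrite -E mem_upair; left.
  rewrite mem_upair => H.
  have : mem x' (upair x x) by case: H => ->; rewrite mem_upair; left.
  by rewrite mem_upair => -[].
subst x'; split=> //.
exact/upair_inj/(upair_inj E).
Qed.

(** * Satisfaction *)

Definition scons (d : U) (v : nat -> U) (n : nat) : U :=
  match n with 0 => d | S m => v m end.

Fixpoint sat (φ : uform) (v : nat -> U) : Prop :=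
  match φ with
  | fBot => False
  | fEq x y => v x = v y
  | fMem x y => mem (v x) (v y)
  | fPred _ x => urelement (v x)
  | fImp φ ψ => sat φ v -> sat ψ v
  | fAll φ => forall d, sat φ (scons d v)
  end.

Lemma sat_ext φ v w :
  (forall k, k < fbound φ -> v k = w k) -> sat φ v <-> sat φ w.
Proof.
elim: φ v w => [|x y|x y|p x|φ IH ψ IH'|φ IH] v w /= vw //.
- by rewrite (vw x) ?(vw y) //; lia.
- by rewrite (vw x) ?(vw y) //; lia.
- by rewrite (vw x) //; lia.
- by rewrite (IH v w) ?(IH' v w) // => k kb; apply: vw; lia.
- suff E d : sat φ (scons d v) <-> sat φ (scons d w) by split=> H d; apply/E.
  by apply: IH => -[|k] //= kb; apply: vw; lia.
Qed.

Lemma sat_ren r φ v : sat (ren r φ) v <-> sat φ (fun n => v (r n)).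
Proof.
elim: φ r v => [|x y|x y|p x|φ IH ψ IH'|φ IH] r v //=; first by rewrite IH IH'.
suff E d : sat (ren (up r) φ) (scons d v) <-> sat φ (scons d (fun n => v (r n))).
  by split=> H d; apply/E.
by rewrite IH; apply: sat_ext => -[|k].
Qed.

(** Flips are automorphisms of the structure [U], so truth is invariant. *)
Lemma sat_act g φ v : sat φ (fun n => act g (v n)) <-> sat φ v.
Proof.
elim: φ v => [|x y|x y|p x|φ IH ψ IH'|φ IH] v //=.
- by split=> [/act_inj|->].
- exact: mem_act.
- exact: urelement_act.
- by rewrite IH IH'.
- have E d : sat φ (scons (act g d) (fun n => act g (v n))) <-> sat φ (scons d v).
    by rewrite -(IH (scons d v)); apply: sat_ext => -[|k].
  split=> H d; first exact/E.
  by rewrite -(actK g d); apply/E.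
Qed.

(** The connectives other than implication and the universal quantifier are
    encoded classically; the following equivalences undo the encoding. *)
Lemma sat_not (φ : uform) v : sat (fNot φ) v <-> ~ sat φ v.
Proof. by []. Qed.
Lemma sat_imp (φ ψ : uform) v : sat (fImp φ ψ) v <-> (sat φ v -> sat ψ v).
Proof. by []. Qed.
Lemma sat_all (φ : uform) v : sat (fAll φ) v <-> forall d, sat φ (scons d v).
Proof. by []. Qed.
Lemma sat_and (φ ψ : uform) v : sat (fAnd φ ψ) v <-> sat φ v /\ sat ψ v.
Proof.
split=> [H|[Hφ Hψ] /= H]; last exact: H.
by split; apply: contrapT => nH; apply: H => /=.
Qed.
Lemma sat_or (φ ψ : uform) v : sat (fOr φ ψ) v <-> sat φ v \/ sat ψ v.
Proof.
split=> /= [H|[Hφ|Hψ] nφ] //.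
by have [Hφ|nφ] := EM (sat φ v); [left | right; apply: H].
Qed.
Lemma sat_iff (φ ψ : uform) v : sat (fIff φ ψ) v <-> (sat φ v <-> sat ψ v).
Proof. exact: sat_and. Qed.
Lemma sat_ex (φ : uform) v : sat (fEx φ) v <-> exists d, sat φ (scons d v).
Proof.
split=> /= [H|[d Hd] nH]; last exact: nH Hd.
by apply: contrapT => nH; apply: H => d Hd; apply: nH; exists d.
Qed.
Lemma sat_mem x y v : sat (fMem x y) v <-> mem (v x) (v y).
Proof. by []. Qed.
Lemma sat_eq x y v : sat (fEq x y) v <-> v x = v y.
Proof. by []. Qed.
Lemma sat_isset x v : sat (isset x) v <-> ~ urelement (v x).
Proof. by []. Qed.
Lemma sat_urel x v : sat (urel x) v <-> urelement (v x).
Proof. by []. Qed.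

Lemma sat_closure φ : (forall v, sat φ v) -> forall v, sat (closure φ) v.
Proof. by rewrite /closure; elim: (fbound φ) => //= n IH H v d; apply: IH. Qed.

Theorem soundness Γ φ (v : nat -> U) :
  deriv Γ φ -> (forall ψ, In ψ Γ -> sat ψ v) -> sat φ v.
Proof.
move=> D; elim: D v => {Γ φ} [Γ φ φΓ|Γ φ ψ _ IH|Γ φ ψ _ IH _ IH'|Γ φ _ IH|Γ φ _ IH
  |Γ φ t _ IH|Γ x|Γ φ x y _ IH _ IH'] v H //=.
- exact: H.
- by move=> Hφ; apply: IH => χ [<-|/H].
- exact/IH/IH'.
- by apply: contrapT => nφ; apply: (IH v) => χ [<-|/H].
- move=> d; apply: IH => χ /in_map_iff[ψ [<- /H]].
  by rewrite sat_ren.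
- rewrite sat_ren; apply: (sat_ext _).2 (IH v H (v t)) => -[|k] //.
- have := IH v H; have := IH' v H; rewrite !sat_ren /= => Hx xy.
  by apply: (sat_ext _).1 Hx => -[|k].
Qed.
(** [sem] replaces satisfaction of a formula by its meaning.  The defined
    connectives are made opaque below so that the rewriting meets them before
    their encodings. *)
Hint Rewrite sat_all sat_imp sat_iff sat_and sat_or sat_not sat_ex sat_eq
  sat_mem sat_isset sat_urel sat_ren : sem.

Ltac sem := rewrite_strat (topdown (hints sem)).

Lemma sat_sub x y v :
  sat (fSub x y) v <-> forall z, mem z (v x) -> mem z (v y).
Proof. by []. Qed.

Opaque fNot fAnd fOr fIff fEx isset fSub.

Hint Rewrite sat_sub : sem.

(** * The axioms of ZFU *)

Lemma supp_bound (v : nat -> U) m : exists n, forall k, k < m -> supp n (v k).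
Proof.
elim: m => [|m [n vn]]; first by exists 0 => k; lia.
have [p vp] := supp_ex (v m); exists (Nat.max n p) => k km.
have [E|km'] : k = m \/ k < m by lia.
- by rewrite E; apply: supp_le vp; lia.
- by apply: supp_le (vn k km'); lia.
Qed.

(** Only finitely many parameters occur in a formula, so a common support of
    their values supports the class that it defines. *)
Lemma supported_sat φ v : supported (fun z => sat φ (scons z v)).
Proof.
have [n vn] := supp_bound v (fbound φ); exists n => g gn z.
rewrite -(sat_act g); apply: (sat_ext _).1 => -[|k] //= kb.
by apply: vn => //; lia.
Qed.

Lemma supported_def φ v (P : U -> Prop) :
  (forall z, sat φ (scons z v) <-> P z) -> supported P.
Proof.
move=> E; have [n H] := supported_sat φ v; exists n => g gn z.
by rewrite -!E; apply: H.
Qed.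

Lemma supported_and (P Q : U -> Prop) :
  supported P -> supported Q -> supported (fun z => P z /\ Q z).
Proof.
move=> [n Pn] [m Qm]; exists (Nat.max n m) => g gnm z [Pz Qz]; split.
- by apply: Pn => //; apply: fixes_le gnm; lia.
- by apply: Qm => //; apply: fixes_le gnm; lia.
Qed.

Lemma supported_mem x : supported (fun z => mem z x).
Proof. exact: (supported_sat (fMem 0 1) (fun _ => x)). Qed.

Lemma ext_valid v : sat (ax_extensionality isset) v.
Proof.
rewrite /ax_extensionality /allS; sem => x /= sx y sy xy.
by apply: mem_ext => // z; rewrite xy.
Qed.

Lemma foundation_valid v : sat (ax_foundation isset) v.
Proof.
rewrite /ax_foundation /allS; sem => x _ [y] /=.
elim/mem_ind: y => y IH yx.
have [[z [zx zy]]|nz] := EM (exists z, mem z x /\ mem z y); first exact: (IH z).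
exists y; split=> // -[z [zx zy]]; apply: nz; by exists z.
Qed.

Lemma pairing_valid v : sat (ax_pairing isset) v.
Proof.
rewrite /ax_pairing /exS; sem => x y /=; exists (upair x y).
by split=> [|z]; [exact: upair_set | rewrite mem_upair or_comm].
Qed.

Lemma union_valid v : sat (ax_union isset) v.
Proof.
rewrite /ax_union /allS /exS; sem => x _ /=.
apply: comprehension; last first.
  by apply: (@supported_def (fEx (fAnd (fMem 0 2) (fMem 1 0))) (fun _ => x)) => z; sem.
by apply: (@small_union (fun y => mem y x) (fun y z => mem z y)) => [|y _]; apply: small_mem.
Qed.

(** The subsets of [x] are indexed by the predicates on a type indexing the
    members of [x]; predicates on a small type form a small type. *)
Lemma powerset_valid v : sat (ax_powerset isset) v.
Proof.
rewrite /ax_powerset /allS /exS; sem => x _ /=.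
apply: comprehension.
- have [X [f fP]] := small_mem x.
  exists (X -> Prop), (fun Q => setof (fun z => exists i, Q i /\ z = f i)) => y [sy yx].
  exists (fun i => mem (f i) y).
  have -> : (fun z => exists i, mem (f i) y /\ z = f i) = (fun z => mem z y).
    apply: funext => z; apply: propext; split=> [[i [fy ->]] //|zy].
    by have [i zi] := fP z (yx z zy); exists i; rewrite -zi.
  by apply: setof_eq => //; [apply: small_mem | apply: supported_mem].
- by apply: (@supported_def (fAnd (isset 0) (fSub 0 1)) (fun _ => x)) => z; sem.
Qed.

Definition succ x := setof (fun z => mem z x \/ z = x).

Lemma small_or (P Q : U -> Prop) : small P -> small Q -> small (fun z => P z \/ Q z).
Proof.
move=> sP sQ; have := @small_bigcup bool (fun b => if b then P else Q).
case=> [[]//|X [f fP]].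
by exists X, f => z [Pz|Qz]; apply: fP; [exists true | exists false].
Qed.

Lemma small_eq x : small (fun z => z = x).
Proof. by exists unit, (fun _ => x) => z ->; exists tt. Qed.

Lemma succP x : is_set_of (fun z => mem z x \/ z = x) (succ x).
Proof.
apply: setofP; first exact/small_or/small_eq/small_mem.
by apply: (@supported_def (fOr (fMem 0 1) (fEq 0 1)) (fun _ => x)) => z; sem.
Qed.

Definition empty := setof (fun _ => False).

Lemma emptyP : is_set_of (fun _ => False) empty.
Proof. by apply: setofP; [exists False, (fun a : False => match a with end) | exists 0]. Qed.

Lemma infinity_valid v : sat (ax_infinity isset) v.
Proof.
rewrite /ax_infinity /exS; sem => /=.
pose num n := Nat.iter n succ empty.
have num0 g : act g empty = empty.
  apply: mem_ext; rewrite ?urelement_act; try by case: emptyP.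
  by move=> z; rewrite -mem_actl; have [_ E] := emptyP; rewrite !E.
have numg g n : act g (num n) = num n.
  elim: n => [|n IH]; first exact: num0.
  rewrite -[num (S n)]/(succ (num n)); have [sn nP] := succP (num n).
  apply: mem_ext; rewrite ?urelement_act // => z.
  rewrite -mem_actl !nP mem_actl IH.
  have -> // : act g z = num n <-> z = num n.
  by rewrite -{1}IH; split=> [/act_inj|->].
have [|] := @comprehension (fun z => exists n, z = num n) (small_image num).
  by exists 0 => g _ z [n ->]; exists n.
move=> w [sw wP]; exists w; split=> //; split.
- exists empty; split; first by apply/wP; exists 0.
  by have [? E] := emptyP; split=> // z; rewrite E.
- move=> z /wP[n ->]; exists (num (S n)); split; first by apply/wP; exists (S n).
  exact: succP.
Qed.

Lemma separation_valid φ v : sat (ax_separation isset φ) v.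
Proof.
apply: sat_closure => {}v; rewrite /allS /exS; sem => x _ /=.
have [|y [sy yP]] := comprehension (small_sub _ (small_mem x))
  (supported_and (supported_mem x) (supported_sat φ (scons x v))).
  by move=> z [].
exists y; split=> // z; rewrite yP.
by rewrite (@sat_ext _ (scons z (scons x v))
  (fun n => scons z (scons y (scons x v)) (up S n))) // => -[|[|k]].
Qed.

(** Functionality bounds the class of values: each argument contributes at most
    one value, so the union over the members of [w] is small. *)
Lemma replacement_valid φ v : sat (ax_replacement isset φ) v.
Proof.
apply: sat_closure => {}v; rewrite /allS /exS; sem => w _ /= H.
pose R x y := sat φ (scons y (scons x (scons w v))).
have fR x : mem x w -> exists y, forall y', R x y' <-> y' = y.
  move=> /H[y Hy]; exists y => y'; rewrite -Hy.
  by apply: sat_ext => -[|[|k]].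
pose r := fun n => match n with 0 => 1 | 1 => 0 | S (S k) => S (S k) end.
have [||y [sy yP]] := @comprehension (fun y => exists x, mem x w /\ R x y).
- apply: small_union (small_mem w) _ => x /fR[y xy].
  by apply: small_sub (small_eq y) => y' /xy.
- apply: (@supported_def (fEx (fAnd (fMem 0 2) (ren r φ))) (scons w v)) => y; sem => /=.
  split=> -[x [xw xy]]; exists x; split=> //; move: xy; apply: (sat_ext _).1 => -[|[|k]] //.
exists y; split=> // z; rewrite yP.
by split=> -[x [xw xy]]; exists x; split=> //; move: xy; apply: (sat_ext _).1 => -[|[|k]].
Qed.

Lemma ZFU_valid φ v : ZFU φ -> sat φ v.
Proof.
case=> [_ []|].
- exact: ext_valid.
- exact: foundation_valid.
- exact: pairing_valid.
- exact: union_valid.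
- exact: powerset_valid.
- exact: infinity_valid.
- move=> ψ; exact: separation_valid.
- move=> ψ; exact: replacement_valid.
- rewrite /ax_urelements; sem => x /= ux [y yx]; exact: mem_not_urelement yx ux.
Qed.

(** * Meaning of the defined notions *)

Lemma sat_all_in x φ v :
  sat (all_in x φ) v <-> forall d, mem d (v x) -> sat φ (scons d v).
Proof. by []. Qed.

Lemma sat_ex_in x φ v :
  sat (ex_in x φ) v <-> exists d, mem d (v x) /\ sat φ (scons d v).
Proof. by rewrite /ex_in; sem. Qed.

Lemma sat_all_set φ v :
  sat (all_set φ) v <-> forall d, ~ urelement d -> sat φ (scons d v).
Proof. by []. Qed.

Lemma sat_ex_set φ v :
  sat (ex_set φ) v <-> exists d, ~ urelement d /\ sat φ (scons d v).
Proof. by rewrite /ex_set /exS; sem. Qed.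

Opaque all_in ex_in all_set ex_set.
Hint Rewrite sat_all_in sat_ex_in sat_all_set sat_ex_set : sem.

Lemma sat_is_upair u x y v : sat (is_upair u x y) v <-> v u = upair (v x) (v y).
Proof. rewrite /is_upair; sem; exact: upairE. Qed.

Opaque is_upair.
Hint Rewrite sat_is_upair : sem.

Lemma sat_is_pair p x y v : sat (is_pair p x y) v <-> v p = pair (v x) (v y).
Proof.
rewrite /is_pair; sem => /=; split=> [[a [b [-> [-> ->]]]] //|->].
by exists (upair (v x) (v x)), (upair (v x) (v y)).
Qed.

Opaque is_pair.
Hint Rewrite sat_is_pair : sem.

Lemma sat_pair_in f x y v : sat (pair_in f x y) v <-> mem (pair (v x) (v y)) (v f).
Proof.
by rewrite /pair_in; sem => /=; split=> [[_ [H <-]]|H] //; exists (pair (v x) (v y)).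
Qed.

Opaque pair_in.
Hint Rewrite sat_pair_in : sem.

Definition product_pred a b z :=
  exists x, mem x a /\ exists y, mem y b /\ z = pair x y.

Definition is_function f a b :=
  ~ urelement f /\ (forall p, mem p f -> product_pred a b p) /\
  forall x, mem x a -> exists y, forall y', mem (pair x y') f <-> y' = y.

Definition surjection f a b :=
  is_function f a b /\ forall y, mem y b -> exists x, mem x a /\ mem (pair x y) f.

Definition bijection f a b :=
  surjection f a b /\
  forall x, mem x a -> forall x', mem x' a -> forall y, mem y b ->
    mem (pair x y) f /\ mem (pair x' y) f -> x = x'.

Definition transitive x := ~ urelement x /\ forall y, mem y x -> forall z, mem z y -> mem z x.

Lemma sat_is_prod c a b v :
  sat (is_prod c a b) v <-> is_set_of (product_pred (v a) (v b)) (v c).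
Proof. by rewrite /is_prod; sem. Qed.

Lemma sat_is_bij f a b v : sat (is_bij f a b) v <-> bijection (v f) (v a) (v b).
Proof. by rewrite /is_bij /is_surj /is_fun; sem. Qed.

Lemma sat_is_surj f a b v : sat (is_surj f a b) v <-> surjection (v f) (v a) (v b).
Proof. by rewrite /is_surj /is_fun; sem. Qed.

Lemma sat_transitive_set x v : sat (transitive_set x) v <-> transitive (v x).
Proof. by rewrite /transitive_set; sem. Qed.

Opaque is_prod is_bij is_surj transitive_set.
Hint Rewrite sat_is_prod sat_is_bij sat_is_surj sat_transitive_set : sem.

Lemma sat_surj_le x y v :
  sat (surj_le x y) v <->
  (exists f, surjection f (v y) (v x)) \/ ~ urelement (v x) /\ forall z, ~ mem z (v x).
Proof. by rewrite /surj_le; sem. Qed.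

Lemma sat_equinumerous x y v :
  sat (equinumerous x y) v <-> exists f, bijection f (v x) (v y).
Proof. by rewrite /equinumerous; sem. Qed.

Definition urelements x := ~ urelement x /\ forall y, mem y x -> urelement y.

Lemma sat_set_of_urelements x v :
  sat (set_of_urelements x) v <-> urelements (v x).
Proof. by rewrite /set_of_urelements; sem. Qed.

Opaque surj_le equinumerous set_of_urelements.
Hint Rewrite sat_surj_le sat_equinumerous sat_set_of_urelements : sem.

(** * Ordinals and Plenitude *)

Definition pure_transitive x := transitive x /\ forall y, mem y x -> ~ urelement y.

(** An ordinal is transitive, so it includes its own transitive closure, which
    contains no urelement. *)
Lemma ordinal_pure x v : sat (is_ordinal x) v -> pure_transitive (v x).
Proof.
rewrite /is_ordinal /is_trcl; sem => /= -[trx [[t [[[_ xt] _] ts]] _]].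
by split=> // y /xt /ts.
Qed.

Lemma mem_irrefl x : ~ mem x x.
Proof. by elim/mem_ind: x => x IH xx; apply: (IH x xx). Qed.

Lemma mem_asym x y : mem x y -> ~ mem y x.
Proof. by elim/mem_ind: x y => x IH y xy yx; apply: (IH y yx x). Qed.

Lemma mem_acyclic3 x y z : mem x y -> mem y z -> ~ mem z x.
Proof. by elim/mem_ind: x y z => x IH y z xy yz zx; apply: (IH z zx x y). Qed.

(** By foundation, comparability is all that is left to check: irreflexivity and
    transitivity hold because membership has no cycles, and least elements are
    membership-minimal ones. *)
Lemma ordinal_intro x v :
  pure_transitive (v x) ->
  (forall y, mem y (v x) -> forall z, mem z (v x) -> mem y z \/ y = z \/ mem z y) ->
  sat (is_ordinal x) v.
Proof.
move=> [trx px] tri; rewrite /is_ordinal /is_trcl /wellordered_by_mem; sem => /=.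
split=> //; split; first by exists (v x); split=> //; split=> // t _ [_].
split; first by move=> y _; apply: mem_irrefl.
split.
  move=> a ax b bx c cx [ab bc].
  have [//|[ac|ca]] := tri a ax c cx.
  - by subst c; case: (mem_asym ab).
  - by case: (mem_acyclic3 ab bc).
split=> // u _ [ux [a]].
elim/mem_ind: a => a IH au.
have [[b [ba bu]]|na] := EM (exists b, mem b a /\ mem b u); first exact: (IH b).
exists a; split=> // b bu.
have [|[->|ba]] := tri a (ux a au) b (ux b bu); [by right | by left|].
by case: na; exists b.
Qed.

Opaque is_ordinal.

Lemma pure_transitive_fixed x : pure_transitive x ->
  forall y, mem y x -> forall g, act g y = y.
Proof.
move=> [[_ tr] px]; elim/mem_ind => y IH yx g.
apply: mem_ext => [||z]; rewrite ?urelement_act; try exact: px.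
have H w : mem w y -> mem w (act g y).
  by move=> wy; rewrite -mem_actl (IH w wy) //; apply: tr yx w wy.
split=> [|/H //]; rewrite -mem_actl => zy.
by have := IH _ zy (tr _ yx _ zy) g; rewrite actK => ->.
Qed.

Lemma small_map (P : U -> Prop) (F : U -> U) :
  small P -> small (fun z => exists x, P x /\ z = F x).
Proof. by move=> sP; apply: small_union sP _ => x _; apply: small_eq. Qed.

(** The set of the inert urelements labelled by the members of an ordinal, and
    the labelling itself, are fixed by all flips. *)
Lemma Plenitude_valid v : sat Plenitude v.
Proof.
rewrite /Plenitude; sem => x /ordinal_pure /= px.
have fx := pure_transitive_fixed px.
have [|a [sa aP]] := comprehension (small_map inert_atom (small_mem x)).
  by exists 0 => g _ z [y [yx ->]]; exists y; rewrite act_inert_atom.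
have [|f [sf fP]] := comprehension (small_map (fun y => pair (inert_atom y) y) (small_mem x)).
  by exists 0 => g _ z [y [yx ->]]; exists y; rewrite act_pair act_inert_atom fx.
exists a; split.
  by split=> // y /aP[z [_ ->]]; apply: urelement_inert_atom.
exists f; split; [split; [split=> //; split|]|].
- move=> p /fP[y [yx ->]]; exists (inert_atom y); split; first by apply/aP; exists y.
  by exists y.
- move=> u /aP[y [yx ->]]; exists y => y'; rewrite fP; split.
  + by case=> z [_ /pair_inj[/inert_atom_inj -> ->]].
  + by move=> ->; exists y.
- by move=> y yx; exists (inert_atom y); rewrite aP fP; split; exists y.
- move=> u _ u' _ y yx; rewrite !fP => -[[z [_ /pair_inj[-> ->]]] [z' [_ /pair_inj[-> ->]]]].
  by [].
Qed.

(** * Small violations of choice *)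

Lemma well_order_ex (X : Type) : exists lt : X -> X -> Prop,
  well_founded lt /\ forall x y, lt x y \/ x = y \/ lt y x.
Proof.
have [Rb woR] := wochoice.well_ordering_principle
  (eqtype.Equality.Pack (eqtype.Equality.Class (boolp.gen_eqMixin X))).
pose R x y := is_true (Rb x y).
have minR (P : X -> Prop) : (exists x, P x) ->
    exists z, (P z /\ forall x, P x -> R z x) /\
      forall y, P y -> (forall x, P x -> R y x) -> y = z.
  move=> [x Px].
  have [|z [[Pz zP] zu]] := woR (fun x => boolp.asbool (P x)).
    by exists x; apply: (boolp.asboolT Px).
  exists z; split; [split|].
  - exact: boolp.asboolW Pz.
  - by move=> y Py; apply: zP (boolp.asboolT Py).
  - move=> y Py yP; apply/esym/zu; split; first exact: (boolp.asboolT Py).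
    by move=> w /boolp.asboolW; apply: yP.
exists (fun x y => ~ R y x); split.
- move=> x; apply: contrapT => nx.
  have [|z [[nz zmin] _]] := minR (fun x => ~ Acc (fun x y => ~ R y x) x); first by exists x.
  apply: nz; constructor=> y zy; apply: contrapT => ny; apply: zy; exact: zmin.
- move=> x y; have [xy|] := EM (R x y); last by right; right.
  have [yx|] := EM (R y x); last by left.
  right; left.
  have [|z [_ zu]] := minR (fun z => z = x \/ z = y); first by exists x; left.
  have rR w : R w w.
    have [|u [[/= uw uP] _]] := minR (fun u => u = w); first by exists w.
    by move: (uP w erefl); rewrite uw.
  have -> : x = z by apply: zu => [|? [->|->]] //; left.
  by apply/esym/zu => [|? [->|->]] //; right.
Qed.

(** Every small type is enumerated without repetition by an ordinal of [U]: the
    von Neumann rank function of a well-order of the type is fixed by all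
    flips. *)
Lemma ordinal_of_type (X : Type) : exists (α : U) (o : X -> U),
  (forall v x, v x = α -> sat (is_ordinal x) v) /\
  is_set_of (fun z => exists i, z = o i) α /\
  injective o /\
  forall g i, act g (o i) = o i.
Proof.
have [lt [wf tri]] := well_order_ex X.
pose step i (rec : forall j, lt j i -> U) := setof (fun z => exists j (h : lt j i), z = rec j h).
pose o : X -> U := Fix wf (fun _ => U) step.
have oE i : o i = setof (fun z => exists j, lt j i /\ z = o j).
  rewrite /o Fix_eq.
    rewrite /step; congr setof; apply: funext => z; apply: propext.
    by split=> [[j [h ->]]|[j [h ->]]]; exists j; [split | exists h].
  move=> x f f' ff'; congr step.
  by apply: boolp.functional_extensionality_dep => y;
    apply: boolp.functional_extensionality_dep => h.
have oP i : is_set_of (fun z => exists j, lt j i /\ z = o j) (o i) /\ forall g, act g (o i) = o i.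
  elim/(well_founded_ind wf): i => i IH.
  have inv g z : (exists j, lt j i /\ z = o j) -> act g z = z.
    by move=> [j [/IH[_ fj] ->]].
  have oi : is_set_of (fun z => exists j, lt j i /\ z = o j) (o i).
    rewrite (oE i); apply: setofP.
    - by apply: small_sub (small_image o) => z [j [_ ->]]; exists j.
    - by exists 0 => g _ z Pz; rewrite inv.
  split=> // g; have [si iP] := oi.
  apply: mem_ext; rewrite ?urelement_act // => z; rewrite -mem_actl !iP.
  split=> Pz; last by rewrite inv.
  by have := inv g _ Pz; rewrite actK => ->.
have [|α [sα αP]] := comprehension (small_image o).
  by exists 0 => g _ z [j ->]; exists j; have [_ ->] := oP j.
have memo i j : lt i j -> mem (o i) (o j).
  by move=> ij; apply/(proj2 (proj1 (oP j))); exists i.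
exists α, o; split; [|split=> //; split].
- move=> v x vx; apply: ordinal_intro; rewrite vx.
  + split; last by move=> y /αP[i ->]; case: (oP i) => -[].
    split=> // y /αP[i ->] z; have [[_ ->] _] := oP i.
    by move=> [j [_ ->]]; apply/αP; exists j.
  + move=> y /αP[i ->] z /αP[j ->].
    have [ij|[->|ji]] := tri i j; [left; exact: memo | by right; left | right; right; exact: memo].
- move=> i j ij; have [/memo|[//|/memo]] := tri i j; rewrite ij => /mem_irrefl //.
- by move=> g i; have [_ ->] := oP i.
Qed.

Lemma product_ex a b : exists c, is_set_of (product_pred a b) c.
Proof.
apply: comprehension.
- apply: small_union (small_mem a) _ => x _.
  exact: small_map (small_mem b).
- apply: (@supported_def
    (fEx (fAnd (fMem 0 2) (fEx (fAnd (fMem 0 4) (is_pair 2 1 0)))))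
    (fun n => match n with 0 => a | _ => b end)) => z.
  by sem.
Qed.

(** The finite partial choice functions on the pairs.  A selection of length [n]
    determines the flips of the first [n] pairs that produced it. *)
Definition selection n h := setof (fun z => exists k, k < n /\ z = moving_atom k (h k)).

Lemma selectionP n h :
  is_set_of (fun z => exists k, k < n /\ z = moving_atom k (h k)) (selection n h).
Proof.
apply: setofP.
- by apply: small_sub (small_image (fun k => moving_atom k (h k))) => z [k [_ ->]]; exists k.
- by exists n => g gn _ [k [kn ->]]; exists k; rewrite act_moving_atom gn.
Qed.

Lemma act_selection g n h : act g (selection n h) = selection n (flip_comp g h).
Proof.
have [s0 sP] := selectionP n h; have [s0' sP'] := selectionP n (flip_comp g h).
apply: mem_ext; rewrite ?urelement_act // => z; rewrite -mem_actl sP sP'.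
split=> -[k [kn E]]; exists k; split=> //.
- by rewrite -(actK g z) E act_moving_atom.
- by rewrite E act_moving_atom /flip_comp -Bool.xorb_assoc Bool.xorb_nilpotent Bool.xorb_false_l.
Qed.

Lemma selection_inj n h h' : selection n h = selection n h' -> forall k, k < n -> h k = h' k.
Proof.
move=> E k kn; have [_ sP] := selectionP n h; have [_ sP'] := selectionP n h'.
have : mem (moving_atom k (h k)) (selection n h') by rewrite -E sP; exists k.
by rewrite sP' => -[k' [_ /moving_atom_inj[-> ->]]].
Qed.

Definition is_selection z := exists n h, z = selection n h.

Lemma act_is_selection g z : is_selection z -> is_selection (act g z).
Proof. by move=> [n [h ->]]; exists n, (flip_comp g h); rewrite act_selection. Qed.

Definition selections := setof is_selection.

Lemma selectionsP : is_set_of is_selection selections.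
Proof.
apply: setofP; last by exists 0 => g _ z; apply: act_is_selection.
apply: small_bigcup => n; exact: small_image.
Qed.

(** This makes the action of a flip on [x] computable from its action on a
    selection of length [n]. *)
Lemma agree_act n x g h : supp n x ->
  (forall k, k < n -> g k = h k) -> act g x = act h x.
Proof.
move=> xn gh; apply: (@act_inj h); rewrite actK act_comp; apply: xn => k kn.
by rewrite /flip_comp gh // Bool.xorb_nilpotent.
Qed.

(** Only flips fixing the support of [x] may be used to move its members, since
    other ones could lead out of [x]; the pairs of a selection and an index
    that are not reached in this way go to a default member. *)
Lemma SVC_valid v : sat SVC v.
Proof.
rewrite /SVC /SVC_of; sem => /=.
have [sS SP] := selectionsP; exists selections; split=> // x sx.
have [X [f fP]] := small_mem x.
have [m xm] := supp_ex x.
have [sup supP] := choice (fun i => supp_ex (f i)).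
have [α [o [ordα [[sα αP] [o_inj fo]]]]] := ordinal_of_type X.
have [c [sc cP]] := product_ex selections α.
exists α; split; first exact: ordα.
exists c; split=> //.
have [[y0 y0x]|nx] := EM (exists y, mem y x); last first.
  by right; split=> // z zx; apply: nx; exists z.
left.
(* [R] relates [g] applied to the pair of a selection and an index to [g]
   applied to the member with that index; [D] handles the other pairs. *)
pose R p y := exists i h,
  fixes m h /\ p = pair (selection (sup i) h) (o i) /\ y = act h (f i) /\ mem (f i) x.
pose D p y := mem p c /\ ~ (exists y, R p y) /\ y = y0.
have R_act g p y : fixes m g -> R p y -> R (act g p) (act g y).
  move=> gm [i [h [hm [-> [-> fx]]]]]; exists i, (flip_comp g h); split; first exact: fixes_comp.
  by rewrite act_pair act_selection fo act_comp.
have R_fun p y y' : R p y -> R p y' -> y = y'.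
  move=> [i [h [_ [-> [-> _]]]]] [i' [h' [_ [/pair_inj[E /o_inj ii'] [-> _]]]]].
  subst i'; exact: agree_act (supP i) (selection_inj E).
have R_dom p y : R p y -> mem p c /\ mem y x.
  move=> [i [h [hm [-> [-> fx]]]]]; split.
  - apply/cP; exists (selection (sup i) h); split; first by apply/SP; exists (sup i), h.
    by exists (o i); split=> //; apply/αP; exists i.
  - by rewrite -(xm h hm) mem_act.
have [m0 y0m] := supp_ex y0.
have cinv g p : mem p c -> mem (act g p) c.
  rewrite !cP => -[s [sS' [a [aα ->]]]]; exists (act g s); split.
    by apply/SP/act_is_selection/SP.
  exists a; split=> //; rewrite act_pair.
  by move: aα; rewrite αP => -[i ->]; rewrite fo.
have [||F [sF FP]] := @comprehension
    (fun z => exists p, mem p c /\ exists y, mem y x /\ z = pair p y /\ (R p y \/ D p y)).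
- apply: small_union (small_mem c) _ => p _.
  apply: small_sub (small_map (pair p) (small_mem x)) => z [y [yx [-> _]]].
  by exists y.
- exists (Nat.max m m0) => g gm z [p [pc [y [yx [-> RD]]]]].
  have gm1 : fixes m g by apply: fixes_le gm; lia.
  have gm0 : fixes m0 g by apply: fixes_le gm; lia.
  exists (act g p); split; first exact: cinv.
  exists (act g y); rewrite act_pair -{1}(xm g gm1) mem_act; split=> //; split=> //.
  case: RD => [/R_act|[_ [nR ->]]]; first by left; auto.
  right; split; first exact: cinv.
  split; last exact: y0m.
  by move=> [y' /(R_act _ _ _ gm1)]; rewrite actK => H; apply: nR; eexists; exact: H.
have FE p y : mem (pair p y) F <-> R p y \/ D p y.
  rewrite FP; split=> [[p' [_ [y' [_ [/pair_inj[-> ->]]]]]] //|RD].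
  exists p; have [pc yx] : mem p c /\ mem y x.
    by case: RD => [/R_dom //|[pc [_ ->]]].
  by split=> //; exists y.
exists F; split.
- split=> //; split.
  + by move=> z /FP[p [pc [y [yx [-> _]]]]]; exists p; split=> //; exists y.
  + move=> p pc; have [[y Rpy]|nR] := EM (exists y, R p y).
    * exists y => y'; rewrite FE; split=> [[/R_fun H|[_ [[]]]]|->]; try by [exists y|left].
      exact: H.
    * exists y0 => y'; rewrite FE; split=> [[Rp|[_ [_]] //]|->]; last by right.
      by case: nR; exists y'.
- move=> y yx; have [i yi] := fP y yx; subst y.
  have Ry : R (pair (selection (sup i) no_flip) (o i)) (f i).
    exists i, no_flip; split=> //; split=> //; split=> //.
    by rewrite (supP i no_flip).
  exists (pair (selection (sup i) no_flip) (o i)); rewrite FE; split; last by left.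
  by have [] := R_dom _ _ Ry.
Qed.

(** * Failure of Plenitude+ *)

Definition flip_at (n : nat) : flips := fun k => Nat.eqb k n.

Lemma fixes_flip_at n m : n <= m -> fixes n (flip_at m).
Proof. by move=> nm k kn; apply/Nat.eqb_neq; lia. Qed.

Lemma selections_not_equinumerous a f : urelements a -> ~ bijection f a selections.
Proof.
move=> [_ ua] [[[_ [fdom fun_f]] surj_f] _].
have [n fn] := supp_ex f.
have [_ SP] := selectionsP.
(* The shortest selection that is moved by the flips of both pairs [n] and
   [S n]. *)
pose e := selection (S (S n)) no_flip.
have [u [uA ue]] : exists u, mem u a /\ mem (pair u e) f.
  by apply: surj_f; apply/SP; exists (S (S n)), no_flip.
have moved k : n <= k -> k < S (S n) -> exists b, u = moving_atom k b.
  move=> nk kn.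
  have gu : act (flip_at k) u <> u.
    move=> E.
    have : mem (pair u (act (flip_at k) e)) f.
      by rewrite -{1}E -act_pair -(fn (flip_at k) (fixes_flip_at nk)) mem_act.
    have [y yP] := fun_f u uA.
    rewrite yP => ey; move: ue; rewrite yP -ey /e act_selection.
    move=> /selection_inj /(_ k kn).
    by rewrite /flip_comp /flip_at Nat.eqb_refl.
  have [k' [b [-> ]]] := urelement_moved (ua u uA) gu.
  by move=> /Nat.eqb_eq ->; exists b.
have [b ub] : exists b, u = moving_atom n b by apply: moved; lia.
have [b' ub'] : exists b, u = moving_atom (S n) b by apply: moved; lia.
have [] : n = S n /\ b = b' by apply: moving_atom_inj; rewrite -ub -ub'.
lia.
Qed.

Lemma PlenitudePlus_fails v : ~ sat PlenitudePlus v.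
Proof.
rewrite /PlenitudePlus; sem => H.
have [sS _] := selectionsP; have [a [/= ua [f fP]]] := H selections sS.
exact: selections_not_equinumerous ua fP.
Qed.

(** * Reflection *)

Fixpoint satin (t : U) (φ : uform) (v : nat -> U) : Prop :=
  match φ with
  | fImp φ ψ => satin t φ v -> satin t ψ v
  | fAll φ => forall d, mem d t -> satin t φ (scons d v)
  | atom => sat atom v
  end.

Lemma sat_relativize φ t v : sat (relativize t φ) v <-> satin (v t) φ v.
Proof.
elim: φ t v => [|x y|x y|p x|φ IH ψ IH'|φ IH] t v //=; first by rewrite IH IH'.
by split=> H d dt; apply/(IH (S t) (scons d v))/H.
Qed.

(** The closure condition of the Tarski–Vaught test, stated for the universal
    quantifier, which is the primitive one: parameters in [P] for which a
    universal formula fails have a counterexample in [Q]. *)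
Definition counterexamples_in (P Q : U -> Prop) :=
  forall φ v, (forall k, k < fbound (fAll φ) -> P (v k)) ->
  (exists d, ~ sat φ (scons d v)) -> exists d, Q d /\ ~ sat φ (scons d v).

Lemma elementary t : counterexamples_in (fun z => mem z t) (fun z => mem z t) ->
  forall φ v, (forall k, k < fbound φ -> mem (v k) t) -> satin t φ v <-> sat φ v.
Proof.
move=> wit; elim=> [|x y|x y|p x|φ IH ψ IH'|φ IH] v //= vt.
- by rewrite IH ?IH' // => k kb; apply: vt; lia.
- have IHd d : mem d t -> satin t φ (scons d v) <-> sat φ (scons d v).
    by move=> dt; apply: IH => -[|k] //= kb; apply: vt; lia.
  split=> [H d|H d dt]; last exact/IHd.
  apply: contrapT => nd; have [|d' [d't nd']] := wit φ v vt; first by exists d.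
  by apply: nd'; apply/IHd/H.
Qed.

(** Formulas with finitely many parameters from a small class form a small type,
    and so do the counterexamples chosen for them.  Parameters are coded as
    maps from [nat] to an option type because only those below the bound of
    the formula have to lie in the class. *)
Lemma witness_step P : small P -> exists Q, small Q /\ counterexamples_in P Q.
Proof.
move=> [X [f fP]].
pose val (c : nat -> option X) k := if c k is Some i then f i else empty.
have [w wP] := choice (P := fun (p : uform * (nat -> option X)) d =>
    (exists d, ~ sat p.1 (scons d (val p.2))) -> ~ sat p.1 (scons d (val p.2)))
  (fun p => match EM (exists d, ~ sat p.1 (scons d (val p.2))) with
   | or_introl (ex_intro d Hd) => ex_intro _ d (fun _ => Hd)
   | or_intror n => ex_intro _ empty (fun H => False_ind _ (n H)) end).
exists (fun d => exists p, d = w p); split; first exact: small_image.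
move=> φ v vP ex.
have [|c cP] := choice (P := fun k o => k < fbound (fAll φ) -> exists i, o = Some i /\ v k = f i).
  move=> k; have [kb|nb] := EM (k < fbound (fAll φ)); last by exists None => /nb.
  by have [i vi] := fP _ (vP k kb); exists (Some i) => _; exists i.
have E d : sat φ (scons d (val c)) <-> sat φ (scons d v).
  apply: sat_ext => -[|k] //= kb; have [|i [ci ->]] := cP k; first by rewrite /=; lia.
  by rewrite /val ci.
exists (w (φ, c)); split; first by exists (φ, c).
by rewrite -E; apply: (wP (φ, c)) => /=; have [d Hd] := ex; exists d; rewrite E.
Qed.

Lemma closure_step (P : U -> Prop) : small P -> exists Q, small Q /\
  counterexamples_in P Q /\ (forall z, P z -> Q z) /\
  (forall y z, P y -> mem z y -> Q z) /\ (forall g z, P z -> Q (act g z)).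
Proof.
move=> sP; have [Q [sQ wQ]] := witness_step sP.
exists (fun z => (Q z \/ P z) \/ (exists y, P y /\ mem z y) \/ (exists g y, P y /\ z = act g y)).
split.
  apply: small_or; first exact: small_or.
  apply: small_or; first by apply: small_union sP _ => y _; apply: small_mem.
  by apply: small_bigcup => g; apply: small_map.
split; last split; last split.
- by move=> φ v vP ex; have [d [Qd nd]] := wQ φ v vP ex; exists d; split=> //; left; left.
- by move=> z Pz; left; right.
- by move=> y z Py zy; right; left; exists y.
- by move=> g z Pz; right; right; exists g, z.
Qed.

(** Any finitely many parameters in the union of the stages already occur at one
    stage, so their counterexamples occur at the next. *)
Lemma elementary_transitive_set x : exists t, transitive t /\ (forall z, mem z x -> mem z t) /\
  counterexamples_in (fun z => mem z t) (fun z => mem z t).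
Proof.
have [next nextP] := choice (P := fun (P : {P | small P}) (Q : {Q | small Q}) =>
    counterexamples_in (sval P) (sval Q) /\
    (forall z, sval P z -> sval Q z) /\
    (forall y z, sval P y -> mem z y -> sval Q z) /\
    (forall g z, sval P z -> sval Q (act g z)))
  (fun P => match closure_step (svalP P) with
    ex_intro Q (conj sQ H) => ex_intro _ (exist _ Q sQ) H end).
pose stage n := Nat.iter n next (exist _ _ (small_mem x)).
have mono n m z : n <= m -> sval (stage n) z -> sval (stage m) z.
  by elim=> // {}m _ IH /IH; have [_ [H _]] := nextP (stage m); apply: H.
have [||t [st tP]] := @comprehension (fun z => exists n, sval (stage n) z).
- by apply: small_bigcup => n; apply: svalP.
- exists 0 => g _ z [n nz]; exists (S n).
  by have [_ [_ [_ H]]] := nextP (stage n); apply: H.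
exists t; split; last split.
- split=> // y /tP[n ny] z zy; apply/tP; exists (S n).
  by have [_ [_ [H _]]] := nextP (stage n); apply: H zy.
- by move=> z zx; apply/tP; exists 0.
- move=> φ v vt ex.
  have [n vn] : exists n, forall k, k < fbound (fAll φ) -> sval (stage n) (v k).
    elim: (fbound _) vt => [|b IH] vt; first by exists 0 => k; lia.
    have [|n vn] := IH; first by move=> k kb; apply: vt; lia.
    have /tP[p vp] := vt b (Nat.lt_succ_diag_r b); exists (Nat.max n p) => k kb.
    have [->|kb'] : k = b \/ k < b by lia.
    + by apply: mono vp; lia.
    + by apply: mono (vn k kb'); lia.
  have [H _] := nextP (stage n); have [d [dn nd]] := H φ v vn ex.
  by exists d; split=> //; apply/tP; exists (S n).
Qed.

(** The iterated bounded quantifiers bind the indices below [n], and push those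
    of [v] up by [n]. *)
Lemma sat_all_in_iter n t φ v (P : U -> Prop) :
  (forall z, P z <-> mem z (v t)) ->
  (forall w, (forall k, k < n -> P (w k)) -> (forall k, w (n + k) = v k) -> sat φ w) ->
  sat (all_in_iter n t φ) v.
Proof.
elim: n t v => [|n IH] t v Pt H /=; first by apply: H => // k; lia.
move=> d dt; apply: (IH (S t) (scons d v)) => //= w wP wv.
apply: H => k; last by have := wv (S k) => /= <-; congr w; lia.
move=> kn; have [->|kn'] : k = n \/ k < n by lia.
- by have := wv 0; rewrite Nat.add_0_r => -> /=; apply/Pt.
- exact: wP.
Qed.

Lemma RP_valid φ v : sat (RP φ) v.
Proof.
rewrite /RP; sem => x _; have [t [trt [xt wit]]] := elementary_transitive_set x.
exists t; split; first exact: trt.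
split; first exact: xt.
apply: (sat_all_in_iter (P := fun z => mem z t)) => // w wt wv.
rewrite sat_iff sat_relativize.
have -> : w (fbound φ) = t by have := wv 0; rewrite Nat.add_0_r => ->.
by rewrite (elementary wit).
Qed.

(** * The independence of Plenitude+ *)

Theorem theorem5 :
  consistent ZF -> ~ proves ZFU_Plenitude_SVC_RP PlenitudePlus.
Proof.
move=> _ [Γ [ax D]]; pose v (_ : nat) := empty.
apply: (PlenitudePlus_fails (v := v)); apply: soundness D _ => ψ ψΓ.
have [] := proj1 (Forall_forall _ _) ax ψ ψΓ.
- by move=> χ; apply: ZFU_valid.
- exact: Plenitude_valid.
- exact: SVC_valid.
- by move=> χ; apply: RP_valid.
Qed.
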